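(* Let $U$ be a second countable profinite group and let $g\in U$. Write $g^U:=\{ugu^{-1}\mid u\in U\}$ for the conjugacy class of $g$. The following are equivalent: (1) $g^U$ is non-meagre in $U$. (2) $g^U$ is open in $U$. (3) $\mu(g^U)>0$, where $\mu$ is the normalized Haar measure on $U$. (4) There is an integer $M>0$ such that $|C_{U/V}(gV)|\leq M$ for every open normal subgroup $V\trianglelefteq U$.
   Context: A profinite group is an inverse limit of finite groups (equivalently, a compact Hausdorff totally disconnected topological group). Normalized Haar measure means $\mu(U)=1$. $C_{U/V}(gV)$ denotes the centralizer of the coset $gV$ in the quotient group $U/V$. A subset is meagre if it is a countable union of nowhere dense sets, and non-meagre otherwise. *)

(* Defs.v *)
From HB Require Import structures.
From mathcomp Require Import all_boot all_order all_algebra.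
From mathcomp Require Import all_classical all_reals all_analysis.

Set Implicit Arguments.
Unset Strict Implicit.
Unset Printing Implicit Defensive.

Local Open Scope classical_set_scope.

HB.mixin Record isTopologicalGroup G of Group G & Topological G := {
  mulg_continuous : continuous (fun x : G * G => (x.1 * x.2)%g) ;
  invg_continuous : continuous (fun x : G => x^-1%g)
}.

(* The distinguished point plays no role in the group theory; it is there
   because the library generates sigma-algebras on pointed types only. *)
#[short(type="topologicalGroupType")]
HB.structure Definition TopologicalGroup :=
  {G of Group G & PointedTopological G & isTopologicalGroup G}.

Definition profinite (U : topologicalGroupType) : Prop :=
  [/\ compact [set: U], hausdorff_space U & totally_disconnected [set: U]].

Definition nowhere_dense (T : topologicalType) (A : set T) : Prop :=
  interior (closure A) = set0.

(* Finite unions are included, since set0 is nowhere dense. *)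
Definition meagre (T : topologicalType) (A : set T) : Prop :=
  exists2 F : (set T)^nat,
    (forall n, nowhere_dense (F n)) & A = \bigcup_n F n.

Section Groups.
Local Open Scope group_scope.
Variable U : groupType.
Implicit Types (g u : U) (A B V : set U).

Definition conj_class g : set U := [set u * g * u^-1 | u in [set: U]].

Definition normal_subgroup V : Prop :=
  [/\ V 1, (forall u v, V u -> V v -> V (u * v)), (forall v, V v -> V v^-1)
    & forall u v, V v -> V (u * v * u^-1)].

Definition lcoset_set u A : set U := [set u * a | a in A].

Definition setmulg A B : set U := [set a * b | a in A & b in B].

(* The quotient group by a normal subgroup V is the set of its cosets, with the
   product of subsets as multiplication. *)
Definition quotient_set V : set (set U) := [set lcoset_set u V | u in [set: U]].

Definition quotient_centralizer V g : set (set U) :=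
  [set X | quotient_set V X /\
           setmulg X (lcoset_set g V) = setmulg (lcoset_set g V) X].

End Groups.

Definition borel (U : topologicalGroupType) := g_sigma_algebraType (@open U).

(* No regularity is required: a finite Borel measure on a second countable
   compact Hausdorff space is automatically regular. *)
Definition normalized_haar (U : topologicalGroupType) (R : realType)
    (mu : probability (borel U) R) : Prop :=
  forall (u : U) (A : set (borel U)), measurable A ->
    mu (lcoset_set u A) = mu A.

(* Main.v *)
Require Import Defs.
From mathcomp Require Import all_boot all_order all_algebra.
From mathcomp Require Import finmap.
From mathcomp Require Import all_classical all_reals all_analysis.

(* For V open and normal, let g^U V be the preimage in U of the conjugacy class
   of gV. Orbit-stabilizer in U/V gives |C_{U/V}(gV)| mu(g^U V) = 1, so
   mu(g^U) > 0 bounds the centralizers. Conversely, if the centralizers are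
   bounded, take V with |C_{U/V}(gV)| maximal. For every smaller W the open set
   g^U V \ g^U W then has measure 0, hence is empty; since g^U is closed, it is
   the intersection of the sets g^U W, so g^U = g^U V is open. A closed
   non-meagre conjugacy class has an interior point, hence is open by
   homogeneity, and the converse is Baire's theorem. *)

Local Open Scope classical_set_scope.
Local Open Scope card_scope.

Set Implicit Arguments.
Unset Strict Implicit.
Unset Printing Implicit Defensive.

Import Order.TTheory GRing.Theory Num.Theory.

(** * Compact Hausdorff spaces: quasi-components and Baire category *)

(** If no such [E] exists, the sets [D] minus [O] generate a proper filter. Its cluster point lies
    outside [O], yet in every closed [D], hence in [O]. *)
Lemma clopen_sub_open (T : topologicalType) (x : T) (O : set T) :
  compact [set: T] -> open O ->
  \bigcap_(D in [set D : set T | D x /\ clopen D]) D `<=` O ->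
  exists E : set T, [/\ E x, clopen E & E `<=` O].
Proof.
move=> cT oO QO.
apply: contrapT => nE.
have PF : ProperFilter (filter_from [set D : set T | D x /\ clopen D]
    (fun D => D `&` ~` O)).
  apply: filter_from_proper.
    apply: filter_from_filter; first by exists setT; split => //; exact: clopenT.
    move=> A B [Ax cA] [Bx cB]; exists (A `&` B).
      by split=> //; exact: clopenI.
    by rewrite [_ `&` _ `&` ~` O]setIIl.
  move=> D [Dx cD]; apply: contrapT => /nonemptyPn/disjoints_subset DO.
  by apply: nE; exists D; split => //; rewrite setCK in DO.
have [p [_ clp]] := cT _ PF filterT.
have : ~ O p.
  move=> Op; have [] := clp (~` O) O; last by move=> z [].
    by exists setT => [|z []//]; split => //; exact: clopenT.
  by apply: open_nbhs_nbhs.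
apply; apply: QO => D [Dx cD].
case: (cD) => _ /closure_id ->; rewrite closureEcluster => A B /= DA.
by apply: clp; exists D => // z [/DA].
Qed.

(** Points that no clopen set separates share a quasi-component. It is connected: normality puts the
    two pieces of a splitting into disjoint open sets, and a clopen set around [x] inside their
    union is cut by them into two clopen sets. *)
Lemma zero_dimensional_compact (T : topologicalType) :
  compact [set: T] -> hausdorff_space T -> totally_disconnected [set: T] ->
  zero_dimensional T.
Proof.
move=> cT hT tdT x y /eqP xy; apply: contrapT => nsep; apply: xy.
(* The quasi-component of x, shown below to be connected. *)
pose Q := \bigcap_(D in [set D : set T | D x /\ clopen D]) D.
have Qx : Q x by move=> D [].
have Qy : Q y.
  by move=> D [Dx cD]; apply: contrapT => nDy; apply: nsep; exists D.
suff cQ : connected Q.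
  have /= : connected_component [set: T] x y.
    exact: (connected_component_max Qx (@subsetT _ Q) cQ).
  by rewrite tdT // => ->.
have clQ : closed Q by apply: closed_bigI => D [_ []].
move=> B -[b Bb] [C oC BC] [D clD BD].
have QB z : Q z -> ~ B z -> ~ C z by move=> Qz nBz Cz; apply: nBz; rewrite BC.
have clB : closed B by rewrite BD; exact: closedI.
have snB : set_nbhs B C.
  by apply/set_nbhsP; exists C; split => //; rewrite BC => z [].
have [N /set_nbhsP [G1 [oG1 BG1 G1N]] NC] := compact_normal hT cT clB snB.
pose G2 := ~` closure N.
have oG2 : open G2 by exact/closed_openC/closed_closure.
have G12 z : G1 z -> G2 z -> False by move=> /G1N/subset_closure.
have QG2 z : Q z -> ~ B z -> G2 z by move=> Qz /(QB _ Qz); apply: contra_not => /NC.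
have QO : Q `<=` G1 `|` G2.
  by move=> z Qz; have [/BG1|/(QG2 _ Qz)] := pselect (B z); [left|right].
have [E [Ex [oE cE] EO]] := clopen_sub_open cT (openU oG1 oG2) QO.
(* [G1] and [G2] are complementary inside [E], so each trace is closed as well as open. *)
have EG1 : clopen (E `&` G1).
  split; first exact: openI.
  suff -> : E `&` G1 = E `&` ~` G2 by apply: closedI => //; exact: open_closedC.
  apply/seteqP; split=> z [Ez] Oz; split=> //; first by move=> /(G12 _ Oz).
  by case: (EO z Ez).
have EG2 : clopen (E `&` G2).
  split; first exact: openI.
  suff -> : E `&` G2 = E `&` ~` G1 by apply: closedI => //; exact: open_closedC.
  apply/seteqP; split=> z [Ez] Oz; split=> //; first by move=> /G12; exact.
  by case: (EO z Ez).
(* The trace containing [x] contains all of [Q]: with [G1] this leaves nothing outside [B], with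
   [G2] it contradicts [B b]. *)
case: (pselect (B x)) => Bx.
  apply/seteqP; split => [|z Qz]; first by rewrite BC => z [].
  apply: contrapT => /(QG2 _ Qz); apply: G12.
  by have [] := Qz (E `&` G1) (conj (conj Ex (BG1 _ Bx)) EG1).
exfalso; apply: (G12 b (BG1 _ Bb)).
have Qb : Q b by move: Bb; rewrite BC => -[].
by have [] := Qb (E `&` G2) (conj (conj Ex (QG2 _ Qx Bx)) EG2).
Qed.

(** Baire's argument: by regularity, shrink [O] to nested nonempty open sets [G n] with the closure
    of [G n.+1] missing [F n]; compactness gives a point in all these closures. *)
Lemma compact_hausdorff_open_not_meagre (T : topologicalType) (O : set T) :
  compact [set: T] -> hausdorff_space T -> open O -> O !=set0 -> ~ meagre O.
Proof.
move=> cT hT oO O0 [F Fnd OF].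
(* The hypotheses on [nG.2] stand inside the existential so that [choice] yields a total function;
   for other inputs the value is the dummy [set0]. *)
have step (nG : nat * set T) : exists G' : set T, open nG.2 -> nG.2 !=set0 ->
    [/\ open G', G' !=set0 & closure G' `<=` nG.2 `&` ~` closure (F nG.1)].
  case: nG => n G /=.
  have [[oG [x Gx]]|nG] := pselect (open G /\ G !=set0); last first.
    by exists set0 => oG G0; case: nG.
  have oD : open (G `&` ~` closure (F n)).
    by apply: openI => //; exact/closed_openC/closed_closure.
  have [y Dy] : (G `&` ~` closure (F n)) !=set0.
    apply: contrapT => /nonemptyPn/disjoints_subset; rewrite setCK => GF.
    have : interior (closure (F n)) x.
      by apply: filterS GF _; apply: open_nbhs_nbhs.
    by rewrite Fnd.
  have [] := compact_regular hT cT (filterT : nbhs y setT)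
    (open_nbhs_nbhs (conj oD Dy)).
  move=> N; rewrite nbhsE => -[N' [oN' N'y] N'N] NG.
  exists N' => _ _; split => //; first by exists y.
  exact: subset_trans (closure_subset N'N) NG.
have [f fP] := choice step.
pose fix G n := if n is m.+1 then f (m, G m) else O.
have GP n : open (G n) /\ G n !=set0.
  elim: n => [//|n [oG G0]]; by have [] := fP (n, G n) oG G0.
have GS n : closure (G n.+1) `<=` G n `&` ~` closure (F n).
  by have [oG G0] := GP n; have [] := fP (n, G n) oG G0.
have GD n m : G (m + n)%N `<=` G n.
  elim: m => [//|m IH]; rewrite addSn.
  by apply: subset_trans IH => z /subset_closure/GS[].
have [x xP] := choice (fun n => (GP n).2).
have PF : ProperFilter (x @ \oo) by apply: fmap_proper_filter.
have [p [_ clp]] := cT _ PF filterT.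
have clGp n : closure (G n) p.
  move=> B nB; apply: clp => //; exists n => // m /= nm.
  by apply: (GD n (m - n)%N); rewrite subnK.
have [Op _] := GS 0%N p (clGp 1%N).
move: Op; rewrite /= OF => -[n _ Fp].
have [_] := GS n p (clGp n.+1); apply; exact: subset_closure.
Qed.

(** * Coset algebra and centralizers modulo a normal subgroup *)

Section Cosets.
Local Open Scope group_scope.
Variable U : groupType.
Implicit Types (g u x y : U) (A H V W : set U).

Definition subgroup_set H : Prop :=
  [/\ H 1, (forall u v, H u -> H v -> H (u * v)) & forall v, H v -> H v^-1].

(** For a subgroup [H], this says that [A] is a union of left cosets of [H]. *)
Definition rinvariant H A : Prop := forall a h, A a -> H h -> A (a * h).

Definition lcosets_of A H : set (set U) := [set lcoset_set a H | a in A].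

Lemma normal_subgroup_set V : normal_subgroup V -> subgroup_set V.
Proof. by case. Qed.

Lemma mem_lcoset u H x : lcoset_set u H x <-> H (u^-1 * x).
Proof.
split; first by move=> [h Hh <-]; rewrite mulKg.
by move=> Hx; exists (u^-1 * x) => //; rewrite mulVKg.
Qed.

Lemma lcoset_eq u v H : subgroup_set H ->
  lcoset_set u H = lcoset_set v H <-> H (u^-1 * v).
Proof.
move=> -[H1 HM HV]; split=> [E|Huv].
  have : lcoset_set v H v by apply/mem_lcoset; rewrite mulVg.
  by rewrite -E => /mem_lcoset.
apply/seteqP; split=> x /mem_lcoset Hx; apply/mem_lcoset.
  by have := HM _ _ (HV _ Huv) Hx; rewrite invgM invgK mulgA mulgK.
by have := HM _ _ Huv Hx; rewrite mulgA mulgK.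
Qed.

Lemma trivIset_lcosets A H : subgroup_set H -> trivIset (lcosets_of A H) id.
Proof.
move=> sH; have [H1 HM HV] := sH; move=> _ _ [a Aa <-] [b Ab <-].
move=> [x [/mem_lcoset ax /mem_lcoset bx]].
apply/(lcoset_eq _ _ sH); have := HM _ _ ax (HV _ bx).
by rewrite invgM invgK mulgA mulgK.
Qed.

Lemma bigcup_lcosets A H : subgroup_set H -> rinvariant H A ->
  \bigcup_(X in lcosets_of A H) X = A.
Proof.
move=> [H1 _ _] AH; apply/seteqP; split=> [x [_ [a Aa <-]] [h Hh <-]|a Aa].
  exact: AH.
exists (lcoset_set a H); first by exists a.
by apply/mem_lcoset; rewrite mulVg.
Qed.

Lemma setmulg_lcoset V u v : normal_subgroup V ->
  setmulg (lcoset_set u V) (lcoset_set v V) = lcoset_set (u * v) V.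
Proof.
move=> [V1 VM VI VJ]; apply/seteqP; split.
  move=> _ [_ [a Va <-]] [_ [b Vb <-] <-].
  apply/mem_lcoset; rewrite invgM !mulgA mulgVK.
  by apply: VM => //; have := VJ v^-1 _ Va; rewrite invgK.
move=> x /mem_lcoset Vx; exists u; first by exists 1 => //; rewrite mulg1.
exists (u^-1 * x); last by rewrite mulVKg.
by apply/mem_lcoset; rewrite mulgA -invgM.
Qed.

Lemma setmulgSr A V W : V `<=` W -> setmulg A V `<=` setmulg A W.
Proof.
by move=> VW _ [x Ax [v Vv <-]]; exists x => //; exists v => //; exact: VW.
Qed.

Lemma sub_setmulg A V : V 1 -> A `<=` setmulg A V.
Proof. by move=> V1 x Ax; exists x => //; exists 1; rewrite ?mulg1. Qed.

Lemma rinvariant_setmulg A V : normal_subgroup V -> rinvariant V (setmulg A V).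
Proof.
move=> [_ VM _ _] _ v [a Aa [w Vw <-]] Vv; exists a => //.
by exists (w * v); [exact: VM|rewrite mulgA].
Qed.

(** The preimage in [U] of the centralizer of [gV] in [U/V]; working in [U] lets its Haar measure be
    taken. *)
Definition centralizer_mod V g : set U :=
  [set x | lcoset_set (x * g) V = lcoset_set (g * x) V].

Lemma quotient_centralizerE V g : normal_subgroup V ->
  quotient_centralizer V g = lcosets_of (centralizer_mod V g) V.
Proof.
move=> nV; apply/seteqP; split=> [X [[u _ <-]]|_ [u Cu <-]].
  by rewrite !setmulg_lcoset // => E; exists u.
by split; [exists u|rewrite !setmulg_lcoset].
Qed.

Lemma sub_centralizer_mod V g : normal_subgroup V -> V `<=` centralizer_mod V g.
Proof.
move=> nV v Vv; rewrite /centralizer_mod /= -!setmulg_lcoset //.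
suff -> : lcoset_set v V = lcoset_set 1 V by rewrite !setmulg_lcoset // mul1g mulg1.
apply/esym/(lcoset_eq _ _ (normal_subgroup_set nV)).
by rewrite invg1 mul1g.
Qed.

Lemma centralizer_mod_subgroup V g : normal_subgroup V ->
  subgroup_set (centralizer_mod V g).
Proof.
move=> nV; have E := setmulg_lcoset _ _ nV; split.
- by rewrite /centralizer_mod /= mul1g mulg1.
- move=> x y; rewrite /centralizer_mod /= => Cx Cy.
  by rewrite -mulgA -(E x) Cy E mulgA -(E (x * g)) Cx E mulgA.
- move=> x; rewrite /centralizer_mod /= => Cx.
  have -> : x^-1 * g = x^-1 * (g * x) * x^-1 by rewrite -!mulgA mulgV mulg1.
  by rewrite -(E (x^-1 * (g * x))) -(E x^-1 (g * x)) -Cx !E !mulgA mulVg mul1g.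
Qed.

(** Makes the orbit map from cosets of the centralizer to conjugates of [gV] both well defined and
    injective. *)
Lemma lcoset_conj_eq V g u t : normal_subgroup V ->
  lcoset_set (u * g * u^-1) V = lcoset_set (t * g * t^-1) V <->
  centralizer_mod V g (u^-1 * t).
Proof.
move=> nV; have E := setmulg_lcoset _ _ nV; rewrite /centralizer_mod /=; split.
  move=> H; have -> : u^-1 * t * g = u^-1 * (t * g * t^-1) * t.
    by rewrite !mulgA mulgVK.
  rewrite -(E (u^-1 * (t * g * t^-1))) -(E u^-1 (t * g * t^-1)) -H !E.
  by rewrite !mulgA mulVg mul1g.
move=> H; have -> : t * g * t^-1 = u * (u^-1 * t * g) * t^-1.
  by rewrite !mulgA mulgV mul1g.
by rewrite -(E (u * (u^-1 * t * g))) -(E u (u^-1 * t * g)) H !E !mulgA mulgK.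
Qed.

End Cosets.

(** * Open subgroups of compact and profinite groups *)

Section TopGroup.
Local Open Scope group_scope.
Variable U : topologicalGroupType.

Lemma continuous_mulg (T : topologicalType) (f g : T -> U) :
  continuous f -> continuous g -> continuous (fun x => f x * g x).
Proof.
move=> cf cg x; apply: (continuous_comp (f := fun z => (f z, g z))
  (g := fun p => p.1 * p.2)); last exact: mulg_continuous.
by apply: cvg_pair; [exact: cf|exact: cg].
Qed.

Lemma continuous_mulgl (u : U) : continuous (fun x : U => u * x).
Proof. apply: continuous_mulg => x; [exact: cvg_cst|exact: cvg_id]. Qed.

Lemma continuous_mulgr (u : U) : continuous (fun x : U => x * u).
Proof. apply: continuous_mulg => x; [exact: cvg_id|exact: cvg_cst]. Qed.

Lemma open_lcoset (u : U) (A : set U) : open A -> open (lcoset_set u A).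
Proof.
move=> oA; suff -> : lcoset_set u A = (fun x => u^-1 * x) @^-1` A.
  by apply: open_comp => // x _; exact: continuous_mulgl.
by apply/seteqP; split=> x /mem_lcoset.
Qed.

Lemma open_rinvariant (V A : set U) :
  open V -> V 1 -> rinvariant V A -> open A.
Proof.
move=> oV V1 AV.
suff -> : A = \bigcup_(a in A) lcoset_set a V.
  by apply: bigcup_open => a _; exact: open_lcoset.
apply/seteqP; split=> [a Aa|_ [a Aa [v Vv <-]]]; last exact: AV.
by exists a => //; apply/mem_lcoset; rewrite mulVg.
Qed.

Lemma open_setmulg (A V : set U) :
  open V -> normal_subgroup V -> open (setmulg A V).
Proof.
move=> oV nV; have [V1 _ _ _] := nV.
by apply: (open_rinvariant oV V1); exact: rinvariant_setmulg.
Qed.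

(** The open cosets of [H] cover [U]; since they are equal or disjoint, a finite subcover lists all
    of them. *)
Lemma finite_lcosets (A H : set U) : compact [set: U] ->
  open H -> subgroup_set H -> finite_set (lcosets_of A H).
Proof.
move=> cU oH sH; have [H1 HM HV] := sH; move: cU; rewrite compact_cover.
move=> /(_ U [set: U] (fun u => lcoset_set u H)) [].
- by move=> u _; exact: open_lcoset.
- by move=> u _; exists u => //; apply/mem_lcoset; rewrite mulVg.
move=> D _ UD.
have : finite_set ((fun u => lcoset_set u H) @` [set` D]).
  exact/finite_image/finite_fset.
apply: sub_finite_set => _ [a Aa <-]; have [d Dd /mem_lcoset da] := UD a I.
by exists d => //; apply/(lcoset_eq _ _ sH).
Qed.

(** Zero-dimensionality gives a clopen [W] around 1 inside [N]. The elements whose insertion into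
    any product [u * v] preserves membership in [W] form a normal subgroup, open by compactness of
    [U * U]. *)
Lemma open_normal_subgroup_nbhs (N : set U) : profinite U -> nbhs 1 N ->
  exists V : set U, [/\ open V, normal_subgroup V & V `<=` N].
Proof.
move=> [cU hU tdU] N1.
have [W [W1 [oW cW]] WN] :=
  zero_dimensional_cvg (x := 1) hU (zero_dimensional_compact cU hU tdU) cU N1.
(* V is the normal core of the stabilizer of W under right translation. *)
pose V : set U := [set x | forall u v, W (u * x * v) <-> W (u * v)].
have nV : normal_subgroup V.
  split.
  - by move=> u v; rewrite mulg1.
  - move=> x y Vx Vy u v; have := Vx u (y * v); have := Vy u v.
    by rewrite !mulgA => -> <-.
  - move=> x Vx u v; have := Vx u (x^-1 * v).
    by rewrite !mulgA mulgK => ->.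
  - move=> t x Vx u v; have := Vx (u * t) (t^-1 * v).
    by rewrite !mulgA mulgK.
have WV : V `<=` W by move=> x /(_ 1 1); rewrite !mulg1 mul1g => ->.
exists V; split => //; last exact: subset_trans WV WN.
suff V1 : nbhs 1 V.
  case: nV => H1 HM _ _; rewrite openE => x Vx.
  have Vxx : nbhs (x^-1 * x) V by rewrite mulVg.
  have : \forall y \near x, V (x^-1 * y) := @continuous_mulgl x^-1 x V Vxx.
  apply: filterS => y /= Vy; rewrite -(mulVKg x y); exact: HM.
(* Tube argument: [W] and its complement are open, so inserting [x] near 1 preserves membership
   locally uniformly in [(u, v)]; compactness makes this uniform. *)
have /compact_near_coveringP ncUU : compact [set: U * U].
  by rewrite -setXTT; exact: compact_setX.
have ch1 : continuous (fun z : (U * U) * U => z.1.1 * z.2 * z.1.2).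
  by do 2?apply: continuous_mulg => // ?; [apply: cvg_comp cvg_fst cvg_fst|
    exact: cvg_snd|apply: cvg_comp cvg_fst cvg_snd].
have ch2 : continuous (fun z : (U * U) * U => z.1.1 * z.1.2).
  by apply: continuous_mulg => // ?; [apply: cvg_comp cvg_fst cvg_fst|
    apply: cvg_comp cvg_fst cvg_snd].
have near_uv (B : set U) (u v : U) : open B -> B (u * v) ->
    \forall z \near (u, v) & x \near 1, B (z.1 * x * z.2) /\ B (z.1 * z.2).
  move=> oB Buv.
  have B1 : nbhs (u * 1 * v) B by apply: open_nbhs_nbhs; rewrite mulg1.
  have B2 : nbhs (u * v) B by exact: open_nbhs_nbhs.
  have M1 : nbhs ((u, v), 1) [set w : (U * U) * U | B (w.1.1 * w.2 * w.1.2)].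
    exact: (ch1 ((u, v), 1) B B1).
  have M2 : nbhs ((u, v), 1) [set w : (U * U) * U | B (w.1.1 * w.1.2)].
    exact: (ch2 ((u, v), 1) B B2).
  exact: filterI M1 M2.
have near_V : \forall x \near 1,
    [set: U * U] `<=` (fun z => W (z.1 * x * z.2) <-> W (z.1 * z.2)).
  apply: ncUU => -[u v] _; have [Wuv|nWuv] := pselect (W (u * v)).
    by apply: filterS (near_uv W u v oW Wuv) => -[z x] /= [].
  by apply: filterS (near_uv (~` W) u v (closed_openC cW) nWuv) => -[z x] /= [].
by apply: filterS near_V => x Vx u v; exact: (Vx (u, v) I).
Qed.
End TopGroup.

(** * Haar measure and orbit-stabilizer *)

Section Haar.
Local Open Scope group_scope.
Variables (U : topologicalGroupType) (R : realType) (mu : probability (borel U) R).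
Hypotheses (pU : profinite U) (haar : normalized_haar mu).
Implicit Types (g : U) (A H V : set U).

Lemma borel_open (A : set U) : open A -> measurable (A : set (borel U)).
Proof. by move=> oA; exact: sub_sigma_algebra. Qed.

Lemma borel_closed (A : set U) : closed A -> measurable (A : set (borel U)).
Proof.
move=> cA; rewrite -[A]setCK; apply: measurableC.
by apply: borel_open; exact: closed_openC.
Qed.

(** [A] is a finite disjoint union of translates of [H], all of measure [mu H]. *)
Lemma haar_lcosets A H : open H -> subgroup_set H -> rinvariant H A ->
  exists2 n : nat, lcosets_of A H #= `I_n & (mu A = n%:R%:E * mu H)%E.
Proof.
move=> oH sH AH; have [cU _ _] := pU; have fin := finite_lcosets A cU oH sH.
have /finite_setP[n cn] := fin; exists n => //.
have mH : measurable (H : set (borel U)) by exact: borel_open.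
rewrite -[in LHS](bigcup_lcosets sH AH) (@measure_fin_bigcup _ _ _ mu) //;
  first last.
- by move=> _ [a _ <-]; apply: borel_open; exact: open_lcoset.
- exact: trivIset_lcosets.
rewrite fsbig_finite //= (eq_big_seq (fun=> mu H)) => [|X].
  by rewrite -(card_fset_set cn) big_const_seq count_predT iter_addr_0 mule_natl.
rewrite in_fset_set // inE => -[a _ <-]; exact: haar.
Qed.

(** Orbit-stabilizer in [U/V], with the stabilizer pulled back to [U]. *)
Lemma lcosets_class_card g V : normal_subgroup V ->
  lcosets_of (setmulg (conj_class g) V) V #=
  lcosets_of [set: U] (centralizer_mod V g).
Proof.
move=> nV; have sV := normal_subgroup_set nV; have [V1 VM VI VJ] := nV.
have sC := centralizer_mod_subgroup g nV; have [C1 _ _] := sC.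
(* The union avoids choosing a representative: on a coset of the centralizer all its terms
   coincide. *)
pose f (X : set U) : set U := \bigcup_(x in X) lcoset_set (x * g * x^-1) V.
have fE u : f (lcoset_set u (centralizer_mod V g)) = lcoset_set (u * g * u^-1) V.
  apply/seteqP; split=> [x [y /mem_lcoset /(lcoset_conj_eq _ _ _ nV) ->] //|x ux].
  by exists u => //; apply/mem_lcoset; rewrite mulVg.
have -> : lcosets_of (setmulg (conj_class g) V) V =
    f @` lcosets_of [set: U] (centralizer_mod V g).
  apply/seteqP; split.
    move=> _ [_ [_ [u _ <-] [v Vv <-]] <-].
    exists (lcoset_set u (centralizer_mod V g)); first by exists u.
    by rewrite fE; apply/(lcoset_eq _ _ sV); rewrite mulKg.
  move=> _ [_ [u _ <-] <-]; rewrite fE; exists (u * g * u^-1) => //.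
  by exists (u * g * u^-1); [exists u|exists 1; rewrite ?mulg1].
apply: inj_card_eq => X Y; rewrite !inE => -[u _ <-] [t _ <-].
by rewrite !fE => /(lcoset_conj_eq _ _ _ nV)/(lcoset_eq _ _ sC).
Qed.

(** Let C be the preimage of the centralizer, and k its index in [U]. Then mu(C) = n mu(V), 1 = k
    mu(C), and by orbit-stabilizer mu(g^U V) = k mu(V). *)
Lemma haar_class_mod g V : open V -> normal_subgroup V ->
  exists2 n : nat, quotient_centralizer V g #= `I_n &
    (n%:R%:E * mu (setmulg (conj_class g) V) = 1)%E.
Proof.
move=> oV nV; have sV := normal_subgroup_set nV; have [V1 VM VI VJ] := nV.
have sC := centralizer_mod_subgroup g nV; have [C1 CM CI] := sC.
have CV : rinvariant V (centralizer_mod V g).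
  by move=> x v Cx Vv; apply: CM => //; exact: sub_centralizer_mod.
have oC : open (centralizer_mod V g) by exact: open_rinvariant CV.
have [n nE Cn] := haar_lcosets oV sV CV.
have TC : rinvariant (centralizer_mod V g) [set: U] by [].
have [k kE Tk] := haar_lcosets oC sC TC.
have [m mE gm] := haar_lcosets oV sV (rinvariant_setmulg (A := conj_class g) nV).
have km : k = m.
  apply/card_eq_II; apply: card_eq_trans mE; apply: card_esym.
  exact: (card_eq_trans (lcosets_class_card g nV) kE).
exists n; first by rewrite quotient_centralizerE.
rewrite gm -km muleCA -Cn -Tk; exact: probability_setT.
Qed.

(** [A] contains a translate of an open normal subgroup, whose finitely many cosets cover [U] and so
    cannot be null. *)
Lemma haar_open_gt0 A : open A -> A !=set0 -> (0 < mu A)%E.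
Proof.
move=> oA [a Aa]; have A1 : nbhs 1 ((fun x => a * x) @^-1` A).
  apply: continuous_mulgl; rewrite mulg1; exact: open_nbhs_nbhs.
have [V [oV nV VA]] := open_normal_subgroup_nbhs pU A1.
have sV := normal_subgroup_set nV.
have TV : rinvariant V [set: U] by [].
have [n _ Tn] := haar_lcosets oV sV TV.
have V0 : (0 < mu V)%E.
  rewrite lt0e measure_ge0 andbT; apply/eqP => V0.
  by have := @probability_setT _ _ _ mu; rewrite Tn V0 mule0 => /eqP;
    rewrite eq_sym onee_eq0.
apply: (lt_le_trans V0); rewrite -(haar a); last exact: borel_open.
apply: le_measure; rewrite ?inE;
  [by apply: borel_open; exact: open_lcoset|exact: borel_open|].
by move=> _ [v Vv <-]; exact: VA.
Qed.

End Haar.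

(** * Topology of a conjugacy class *)

Section ConjClass.
Local Open Scope group_scope.
Variables (U : topologicalGroupType) (g : U).

Lemma closed_conj_class :
  compact [set: U] -> hausdorff_space U -> closed (conj_class g).
Proof.
move=> cU hU; apply: compact_closed => //; apply: continuous_compact => //.
apply: continuous_subspaceT; apply: continuous_mulg => //.
  exact: continuous_mulgr.
exact: invg_continuous.
Qed.

Lemma open_conj_class : interior (conj_class g) !=set0 -> open (conj_class g).
Proof.
move=> [_ /[dup] /interior_subset [u _ <-] gu]; rewrite openE => _ [t _ <-].
(* Conjugation by [s] preserves the class and moves the given point to the interior point. *)
pose s := u * t^-1; pose c x := s * x * s^-1.
have cc : continuous c.
  apply: continuous_mulg => x; [exact: continuous_mulgl|exact: cvg_cst].
have ct : c (t * g * t^-1) = u * g * u^-1.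
  by rewrite /c /s invgM invgK !mulgA !mulgVK.
have cN : nbhs (c (t * g * t^-1)) (conj_class g) by rewrite ct.
have : \forall x \near t * g * t^-1, conj_class g (c x) := cc _ _ cN.
move=> tN; apply: filterS tN => x [w _ wx].
exists (t * u^-1 * w) => //; have -> : x = s^-1 * c x * s.
  by rewrite /c -(mulgA s) mulKg mulgVK.
by rewrite -wx /s !invgM !invgK !mulgA.
Qed.

Lemma conj_class_open_mod (V : set U) :
  profinite U -> open V -> normal_subgroup V ->
  (forall W, open W -> normal_subgroup W -> W `<=` V ->
     setmulg (conj_class g) V `<=` setmulg (conj_class g) W) ->
  open (conj_class g).
Proof.
move=> pU oV nV VW; have [cU hU _] := pU.
suff -> : conj_class g = setmulg (conj_class g) V by exact: open_setmulg.
have [V1 VM VI VJ] := nV; apply/seteqP; split; first exact: sub_setmulg.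
move=> y yV; apply: contrapT => ngy.
have N1 : nbhs 1 ((fun x => y * x) @^-1` (~` conj_class g)).
  apply: continuous_mulgl; rewrite mulg1; apply: open_nbhs_nbhs; split=> //.
  exact/closed_openC/closed_conj_class.
have [W0 [oW0 nW0 W0N]] := open_normal_subgroup_nbhs pU N1.
have [W1 WM WI WJ] := nW0.
(* The coset of [y] modulo [W0] misses the class; intersecting with [V] makes the hypothesis [VW]
   applicable. *)
have nW : normal_subgroup (W0 `&` V).
  split=> //; first by move=> u v [? ?] [? ?]; split; [exact: WM|exact: VM].
    by move=> v [? ?]; split; [exact: WI|exact: VI].
  by move=> u v [? ?]; split; [exact: WJ|exact: VJ].
have [x gx [w [Ww _] xw]] := VW _ (openI oW0 oV) nW (@subIsetr _ _ _) y yV.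
by apply: (W0N _ (WI _ Ww)); rewrite -xw mulgK.
Qed.
End ConjClass.

(** * The cycle of implications between the four conditions *)

Unset Implicit Arguments.

Theorem theorem1p1 (U : topologicalGroupType) (R : realType)
    (mu : probability (borel U) R) (g : U) :
  profinite U -> @second_countable U -> normalized_haar mu ->
  [<-> ~ meagre (conj_class g);
       open (conj_class g);
       (0 < mu (conj_class g))%E;
       exists M : nat, (0 < M)%N /\
         forall V : set U, open V -> normal_subgroup V ->
           quotient_centralizer V g #<= `I_M].
Proof.
move=> pU _ haar; have [cU hU _] := pU.
have clg := closed_conj_class cU hU (g := g).
have gg : conj_class g g by exists 1%g => //; rewrite mul1g invg1 mulg1.
tfae.
- move=> nm; apply: open_conj_class; apply: contrapT => /nonemptyPn i0.
  (* A closed set with empty interior is nowhere dense, so a constant sequence suffices. *)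
  apply: nm; exists (fun=> conj_class g).
    by move=> _; rewrite /nowhere_dense -(closure_id _).1.
  by rewrite bigcup_const //; exists 0%N.
- by move=> og; apply: haar_open_gt0 => //; exists g.
- move=> g0.
  have gfin : mu (conj_class g) \is a fin_num.
    by apply: fin_num_measure; exact: borel_closed.
  pose r := fine (mu (conj_class g)).
  have r0 : (0 < r)%R by rewrite -lte_fin fineK.
  (* If n is the order of the centralizer, n r is at most n mu(g^U V) = 1, so n is at most 1/r,
     which is below this bound. *)
  exists (Num.truncn r^-1).+1; split=> // V oV nV.
  have [n nE Vn] := haar_class_mod pU haar g oV nV.
  rewrite (card_le_eql nE) card_le_II.
  have nr : (n%:R * r <= 1)%R.
    rewrite -lee_fin EFinM fineK // -Vn; apply: lee_wpmul2l => //.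
    apply: le_measure; rewrite ?inE; [exact: borel_closed| |].
      by apply: borel_open; exact: open_setmulg.
    by apply: sub_setmulg; have [] := nV.
  have : (n%:R < (Num.truncn r^-1).+1%:R :> R)%R.
    by apply: le_lt_trans (truncnS_gt _); rewrite -div1r ler_pdivlMr.
  by rewrite ltr_nat => /ltnW.
- move=> [M [_ VM]].
  suff og : open (conj_class g).
    by apply: compact_hausdorff_open_not_meagre => //; exists g.
  (* A centralizer of maximal order n is attained at V; passing to W below V can
     no longer shrink the measure 1/n of the preimage of the class. *)
  pose P n := `[< exists V : set U,
    [/\ open V, normal_subgroup V & quotient_centralizer V g #= `I_n] >].
  have exP : exists n, P n.
    have [V [oV nV _]] := open_normal_subgroup_nbhs pU (filterT : nbhs 1%g setT).
    have [n nE _] := haar_class_mod pU haar g oV nV.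
    by exists n; apply/asboolP; exists V.
  have Pub n : P n -> (n <= M)%N.
    move=> /asboolP[V [oV nV nE]]; rewrite -card_le_II -(card_le_eql nE).
    exact: VM.
  have [n /asboolP[V [oV nV nE]] nmax] := ex_maxnP exP Pub.
  apply: (conj_class_open_mod pU oV nV) => W oW nW WV.
  have [n' nE' Vn] := haar_class_mod pU haar g oV nV.
  have {n' nE'} Vn : (n%:R%:E * mu (setmulg (conj_class g) V) = 1)%E.
    suff -> : n = n' by [].
    by apply/card_eq_II; apply: card_eq_trans nE'; rewrite card_eq_sym.
  have [m mE Wm] := haar_class_mod pU haar g oW nW.
  have mn : (m <= n)%N by apply: nmax; apply/asboolP; exists W.
  set A := setmulg _ V in Vn *; set B := setmulg _ W in Wm *.
  have oA : open A by exact: open_setmulg.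
  have oB : open B by exact: open_setmulg.
  have BA : B `<=` A by exact: setmulgSr.
  (* [A] and [B] are both unions of cosets of [W], hence so is their difference. *)
  have oAB : open (A `\` B).
    have [W1 _ WI _] := nW; apply: (open_rinvariant oW W1) => a w [Aa nBa] Ww; split.
      exact: rinvariant_setmulg nV _ _ Aa (WV _ Ww).
    move=> Baw; apply: nBa; rewrite -(mulgK w a).
    exact: rinvariant_setmulg nW _ _ Baw (WI _ Ww).
  (* Otherwise the nonempty open difference has positive measure, and 1 = m mu(B) <= n mu(B) < n
     mu(A) = 1. *)
  apply: contrapT => nAB.
  have AB0 : (0 < mu (A `\` B))%E.
    apply: (haar_open_gt0 pU haar) => //; apply: contrapT => /nonemptyPn AB0.
    by apply: nAB; rewrite -setD_eq0.
  have AE : (mu A = mu B + mu (A `\` B))%E.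
    rewrite -[in LHS](setDUK BA) measureU //; last exact: setDIK.
    - exact: borel_open.
    - exact: borel_open.
  have n0 : (0 < n)%N.
    by case: (n) Vn => [|//]; rewrite mul0e => /esym/eqP; rewrite onee_eq0.
  have : (m%:R%:E * mu B < n%:R%:E * mu A)%E.
    apply: (@le_lt_trans _ _ (n%:R%:E * mu B)%E).
      by apply: lee_wpmul2r; rewrite ?lee_fin ?ler_nat ?measure_ge0.
    rewrite lte_pmul2l ?lte_fin ?ltr0n // AE lteDl //.
    by apply: fin_num_measure; exact: borel_open.
  by rewrite Vn Wm ltxx.
Qed.
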